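(* Let $(\Omega,\Sigma,\lambda)$ be a probability space, $L_1=L_1(\Omega,\Sigma,\lambda)$, and let $X\subset L_1$ be a closed subspace. If $X$ is rich in $L_1$, then $\frac12 B(L_1)\subset C_X$.
   Context: Scalars are real or complex. For a Banach space $W$, $B(W)$ is its closed unit ball and $S(W)$ its unit sphere. A slice of $B(W)$ is a nonvoid set of the form $\{w\in B(W): \operatorname{Re} w^*(w)>\alpha\}$ with $w^*\in W^*$, $\alpha\in\mathbb{R}$. An operator $T\colon W\to V$ between Banach spaces is narrow if for every $x,y\in S(W)$, every $\varepsilon>0$ and every slice $S$ of $B(W)$ containing $y$ there is $v\in S$ with $\|x+v\|>2-\varepsilon$ and $\|T(y-v)\|<\varepsilon$. A closed subspace $Z$ of $W$ is rich in $W$ if the quotient map $q\colon W\to W/Z$ is narrow. For a closed subspace $X\subset L_1$, $C_X$ denotes the closure of the ball $B(X)$ (unit ball for the $L_1$-norm) in $L_1$ with respect to the topology of convergence in measure (the $L_0$-topology). *)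

(* Defs.v *)
From HB Require Import structures.
From mathcomp Require Import all_boot all_order all_algebra.
From mathcomp Require Import generic_quotient ring_quotient.
From mathcomp Require Import complex.
From mathcomp Require Import all_classical all_reals all_analysis.
From mathcomp Require Import measurable_realfun.

Set Implicit Arguments.
Unset Strict Implicit.
Unset Printing Implicit Defensive.

Import Order.TTheory GRing.Theory Num.Theory.
Import numFieldTopology.Exports numFieldNormedType.Exports.

Local Open Scope classical_set_scope.
Local Open Scope ring_scope.
Local Open Scope quotient_scope.

(* The field of scalars is R or R[i]. In the complex case the library orders
   R[i] by x <= y iff y - x is a nonnegative real, and the norm of a
   [normedModType R[i]] takes its values in R[i]; so, uniformly in k,
   [0 < eps] says that eps is a positive real. *)
Variant scalar_kind := RealScalars | ComplexScalars.

Definition scalars (R : realType) (k : scalar_kind) : numFieldType :=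
  match k with
  | RealScalars => R
  | ComplexScalars => R[i]
  end.

Definition sre (R : realType) (k : scalar_kind) : scalars R k -> R :=
  match k with
  | RealScalars => id
  | ComplexScalars => @complex.Re R
  end.

Definition sim (R : realType) (k : scalar_kind) : scalars R k -> R :=
  match k with
  | RealScalars => fun=> 0
  | ComplexScalars => @complex.Im R
  end.

Definition sreal (R : realType) (k : scalar_kind) : R -> scalars R k :=
  match k with
  | RealScalars => id
  | ComplexScalars => fun x => Complex x 0
  end.

Arguments sreal {R} k _.

(* The modulus as a real number; the norm of the field is field-valued. *)
Definition sabs (R : realType) (k : scalar_kind) (z : scalars R k) : R :=
  sre `|z|.

Section ScalarTheory.
Context {R : realType} {k : scalar_kind}.
Implicit Types (z w : scalars R k) (x y : R).

Lemma sreD z w : sre (z + w) = sre z + sre w.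
Proof. by case: k z w => //= -[? ?] [? ?]. Qed.

Lemma simD z w : sim (z + w) = sim z + sim w.
Proof. by case: k z w => /= [_ _|[? ?] [? ?]//]; rewrite addr0. Qed.

Lemma sreM z w : sre (z * w) = sre z * sre w - sim z * sim w.
Proof. by case: k z w => /= [z w|[? ?] [? ?]//]; rewrite mul0r subr0. Qed.

Lemma simM z w : sim (z * w) = sre z * sim w + sim z * sre w.
Proof. by case: k z w => /= [z w|[? ?] [? ?]//]; rewrite mulr0 mul0r addr0. Qed.

Lemma sabsE z : sabs z = Num.sqrt (sre z ^+ 2 + sim z ^+ 2).
Proof.
rewrite /sabs; case: k z => /= [z|[a b]//].
by rewrite expr0n addr0 sqrtr_sqr.
Qed.

Lemma srealK : cancel (@sreal R k) (@sre R k).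
Proof. by case: k. Qed.

Lemma sreal_sabs z : sreal k (sabs z) = `|z|.
Proof. by rewrite /sabs; case: k z => /= [z|[a b]]. Qed.

Lemma sreal_sre z : 0 <= z -> sreal k (sre z) = z.
Proof.
by move=> z0; rewrite -{2}(ger0_norm z0) -sreal_sabs /sabs ger0_norm.
Qed.

Lemma sreal_norm (V : normedModType (scalars R k)) (v : V) :
  sreal k (sre `|v|) = `|v|.
Proof. exact: sreal_sre. Qed.

Lemma sreal0 : sreal k (0 : R) = 0.
Proof. by case: k. Qed.

Lemma srealD x y : sreal k (x + y) = sreal k x + sreal k y.
Proof. by case: k => //=; congr Complex; rewrite addr0. Qed.

Lemma srealM x y : sreal k (x * y) = sreal k x * sreal k y.
Proof.
case: k => //=; congr Complex; first by rewrite mul0r subr0.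
by rewrite mulr0 mul0r addr0.
Qed.

Lemma sreal_le x y : (sreal k x <= sreal k y) = (x <= y).
Proof. by case: k => //=; rewrite lecE /= eqxx. Qed.

Lemma sreal_lt x y : (sreal k x < sreal k y) = (x < y).
Proof. by case: k => //=; rewrite ltcE /= eqxx. Qed.

Lemma sabs_ge0 z : 0 <= sabs z.
Proof. by rewrite sabsE sqrtr_ge0. Qed.

Lemma sabsD z w : sabs (z + w) <= sabs z + sabs w.
Proof. by rewrite -sreal_le srealD !sreal_sabs ler_normD. Qed.

Lemma sabsM z w : sabs (z * w) = sabs z * sabs w.
Proof.
by apply: (can_inj srealK); rewrite srealM !sreal_sabs normrM.
Qed.

Lemma sabsN z : sabs (- z) = sabs z.
Proof. by rewrite /sabs normrN. Qed.

Lemma sabs0 : sabs (0 : scalars R k) = 0.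
Proof. by rewrite /sabs normr0; case: k. Qed.

Lemma sabs_eq0 z : (sabs z == 0) = (z == 0).
Proof. by rewrite -(inj_eq (can_inj srealK)) sreal_sabs sreal0 normr_eq0. Qed.

End ScalarTheory.

Section LmodQuotient.
Context {K : pzRingType} {V : lmodType K} (Z : submodClosed V).

Definition subspace_pred : {pred V} := Z.

Let subspace_pred_zmod : zmod_closed subspace_pred.
Proof.
split=> [|u v uZ vZ]; first exact: (@rpred0 _ Z).
rewrite -scaleN1r; apply: (@rpredD _ Z) => //.
exact: (@rpredZ _ _ Z).
Qed.

HB.instance Definition _ :=
  GRing.isZmodClosed.Build V subspace_pred subspace_pred_zmod.

Definition lquot : Type := Quotient.quot subspace_pred.

HB.instance Definition _ := Choice.on lquot.
HB.instance Definition _ := EqQuotient.on lquot.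
HB.instance Definition _ := GRing.Zmodule.on lquot.
HB.instance Definition _ := ZmodQuotient.on lquot.

Definition lquot_scale (a : K) (q : lquot) : lquot := \pi_lquot (a *: repr q).

Lemma lquot_eqP (u v : V) : reflect (\pi_lquot u = \pi_lquot v) (u - v \in Z).
Proof.
apply: (iffP idP) => [uv|/eqP uv].
  by apply/eqP; rewrite -Quotient.idealrBE.
by move: uv; rewrite -Quotient.idealrBE.
Qed.

Lemma pi_lquotZ a v : \pi_lquot (a *: v) = lquot_scale a (\pi_lquot v).
Proof.
apply/lquot_eqP; rewrite -scalerBr; apply: rpredZ.
by apply/lquot_eqP; rewrite reprK.
Qed.

Let lquot_ind (P : lquot -> Prop) :
  (forall v, P (\pi_lquot v)) -> forall q, P q.
Proof. by move=> h q; rewrite -[q]reprK; apply: h. Qed.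

Let lquot_scaleA a b q :
  lquot_scale a (lquot_scale b q) = lquot_scale (a * b) q.
Proof.
elim/lquot_ind: q => v.
by rewrite -(pi_lquotZ b) -(pi_lquotZ a) -(pi_lquotZ (a * b)) scalerA.
Qed.

Let lquot_scale1 : left_id 1 lquot_scale.
Proof. by elim/lquot_ind => v; rewrite -(pi_lquotZ 1) scale1r. Qed.

Let pi_lquotD u v : \pi_lquot u + \pi_lquot v = \pi_lquot (u + v).
Proof. by rewrite raddfD. Qed.

Let lquot_scaleDr : right_distributive lquot_scale +%R.
Proof.
move=> a; elim/lquot_ind => u; elim/lquot_ind => v.
rewrite -(pi_lquotZ a u) -(pi_lquotZ a v) !pi_lquotD.
by rewrite -(pi_lquotZ a (u + v)) scalerDr.
Qed.

Let lquot_scaleDl q : {morph lquot_scale^~ q : a b / a + b}.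
Proof.
elim/lquot_ind: q => v a b.
rewrite -(pi_lquotZ a) -(pi_lquotZ b) -(pi_lquotZ (a + b)).
by rewrite scalerDl pi_lquotD.
Qed.

HB.instance Definition _ := GRing.Zmodule_isLmodule.Build K lquot
  lquot_scaleA lquot_scale1 lquot_scaleDr lquot_scaleDl.

Definition qmap (v : V) : lquot := \pi_lquot v.

Let qmap_linear : linear qmap.
Proof.
by move=> a u v; rewrite /qmap -pi_lquotD (pi_lquotZ a u).
Qed.

HB.instance Definition _ :=
  GRing.isLinear.Build K V lquot *:%R qmap qmap_linear.

Lemma qmap_surj q : exists v, qmap v = q.
Proof. by exists (repr q); rewrite /qmap reprK. Qed.

Lemma qmap_eq0 v : (qmap v = 0) <-> (v \in Z).
Proof.
rewrite -(raddf0 qmap); split => [/lquot_eqP|vZ]; first by rewrite subr0.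
by apply/lquot_eqP; rewrite subr0.
Qed.

End LmodQuotient.

Section NormedQuotient.
Context {R : realType} {k : scalar_kind}.
Local Notation K := (scalars R k).
Context {V : normedModType K} {Z : submodClosed V}.

(* The proof that Z is closed is what makes the quotient seminorm a norm. *)
Definition quotient of closed [set` Z] : Type := lquot Z.

Context (clZ : closed [set` Z]).
Local Notation Q := (quotient clZ).

HB.instance Definition _ := GRing.Lmodule.on Q.

Definition quotient_norm (q : Q) : K :=
  sreal k (inf [set sre `|v| | v in [set v | qmap Z v = q]]).

Let N (q : Q) : R := inf [set sre `|v| | v in [set v | qmap Z v = q]].

Let sren_ge0 (v : V) : 0 <= sre `|v|.
Proof. by rewrite -(@sreal_le _ k) sreal_norm sreal0. Qed.

Let N_has_inf q : has_inf [set sre `|v| | v in [set v | qmap Z v = q]].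
Proof.
split; first by case: (qmap_surj q) => v vq; exists (sre `|v|), v.
by exists 0 => _ [v _ <-].
Qed.

Let N_le v q : qmap Z v = q -> N q <= sre `|v|.
Proof. by move=> vq; apply: ge_inf; [case: (N_has_inf q)|exists v]. Qed.

Let le_N q x : (forall v, qmap Z v = q -> x <= sre `|v|) -> x <= N q.
Proof.
move=> h; apply: lb_le_inf; first by case: (N_has_inf q).
by move=> _ [v vq <-]; apply: h.
Qed.

Let N_ge0 q : 0 <= N q.
Proof. exact: le_N. Qed.

Let ND (p q : Q) : N (p + q) <= N p + N q.
Proof.
rewrite -lerBlDr; apply: le_N => u uq.
rewrite lerBlDr -lerBlDl; apply: le_N => v vq.
rewrite lerBlDl; apply: (@le_trans _ _ (sre `|u + v|)).
  apply: N_le; rewrite (linearD (qmap Z)). by congr (_ + _).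
by rewrite -(@sreal_le _ k) srealD !sreal_norm ler_normD.
Qed.

Let N0 : N 0 = 0.
Proof.
apply/eqP; rewrite eq_le N_ge0 andbT.
apply: (le_trans (@N_le 0 _ _)); first exact: raddf0.
by rewrite -(@sreal_le _ k) sreal_norm normr0 sreal0.
Qed.

Let NZle a (q : Q) : N (a *: q) <= sabs a * N q.
Proof.
have [->|a0] := eqVneq a 0; first by rewrite scale0r N0 sabs0 mul0r.
have sa0 : 0 < sabs a by rewrite lt_def sabs_ge0 sabs_eq0 a0.
rewrite -ler_pdivrMl//; apply: le_N => v vq.
rewrite ler_pdivrMl//; apply: (le_trans (@N_le (a *: v) _ _)).
  by rewrite linearZ/= vq.
by rewrite -(@sreal_le _ k) srealM !sreal_norm normrZ.
Qed.

Let NZ a (q : Q) : N (a *: q) = sabs a * N q.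
Proof.
have [->|a0] := eqVneq a 0; first by rewrite scale0r N0 sabs0 mul0r.
have sa0 : 0 < sabs a by rewrite lt_def sabs_ge0 sabs_eq0 a0.
apply/eqP; rewrite eq_le NZle/= -ler_pdivlMl//.
have -> : (sabs a)^-1 = sabs a^-1.
  apply: (mulfI (lt0r_neq0 sa0)); rewrite -sabsM !divff// ?gt_eqF//.
  by rewrite /sabs normr1; case: (k).
by rewrite -{1}[q](scalerK a0) NZle.
Qed.

Let quotient_normD (p q : Q) :
  quotient_norm (p + q) <= quotient_norm p + quotient_norm q.
Proof. by rewrite /quotient_norm -srealD sreal_le; apply: ND. Qed.

Let quotient_normZ a (q : Q) : quotient_norm (a *: q) = `|a| * quotient_norm q.
Proof. by rewrite /quotient_norm -sreal_sabs -srealM -NZ. Qed.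

Let quotient_norm_eq0 (q : Q) : quotient_norm q = 0 -> q = 0.
Proof.
rewrite /quotient_norm -(@sreal0 R k) => /(can_inj srealK) Nq0.
have [v vq] := qmap_surj q; rewrite -vq; apply/qmap_eq0.
suff : [set` Z] v by [].
rewrite ((closure_id _).1 clZ) => A /nbhs_ballP[e /= e0 veA].
have e0' : 0 < sre e.
  by rewrite -(@sreal_lt _ k) sreal0 sreal_sre// ltW.
have [_ [w wq <-]] := inf_adherent e0' (N_has_inf q).
rewrite Nq0 add0r => we; exists (v - w); split => /=.
  by apply/lquot_eqP; rewrite -/(qmap _ v) vq.
apply: veA; rewrite -ball_normE/= opprB addrC subrK.
by rewrite -(sreal_sre (ltW e0)) -sreal_norm sreal_lt.
Qed.

HB.instance Definition _ := Lmodule_isNormed.Build K Q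
  quotient_normD quotient_normZ quotient_norm_eq0.

Definition quotient_map : V -> Q := qmap Z.

HB.instance Definition _ := GRing.Linear.on quotient_map.

Lemma quotient_map_continuous : continuous quotient_map.
Proof.
apply: bounded_linear_continuous; apply/linear_boundedP.
near=> r => v; apply: (@le_trans _ _ `|v|).
  by rewrite -(sreal_norm v) sreal_le; apply: ge_inf;
    [exists 0 => _ [w _ <-]|exists v].
by rewrite ler_peMl//; near: r; apply: nbhs_pinfty_ge; rewrite num_real.
Unshelve. all: by end_near. Qed.

End NormedQuotient.

Section NarrowOperator.
Context {R : realType} {k : scalar_kind}.
Local Notation K := (scalars R k).

Definition unit_ball (W : normedModType K) : set W := [set w | `|w| <= 1].

Definition unit_sphere (W : normedModType K) : set W := [set w | `|w| = 1].

Definition slice (W : normedModType K) (S : set W) : Prop :=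
  S !=set0 /\
  exists (phi : {linear W -> K^o}) (alpha : R),
    continuous phi /\ S = [set w | unit_ball w /\ alpha < sre (phi w)].

Definition narrow (W V : normedModType K) (T : {linear W -> V}) : Prop :=
  forall (x y : W) (eps : K) (S : set W),
    unit_sphere x -> unit_sphere y -> 0 < eps -> slice S -> S y ->
    exists v, [/\ S v, 2 - eps < `|x + v| & `|T (y - v)| < eps].

Definition rich (W : normedModType K) (Z : submodClosed W)
    (clZ : closed [set` Z]) : Prop :=
  narrow (quotient_map clZ).

End NarrowOperator.

Arguments unit_ball {R k} W.
Arguments unit_sphere {R k} W.

Section L1.
Context {d : measure_display} {Omega : measurableType d} {R : realType}.
Context (lambda : probability Omega R) (k : scalar_kind).
Local Notation K := (scalars R k).

(* No Borel sigma-algebra is attached to R[i]: measurability is that of the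
   real and imaginary parts. *)
Definition smeasurable (f : Omega -> K) : Prop :=
  measurable_fun setT (fun w => sre (f w)) /\
  measurable_fun setT (fun w => sim (f w)).

Lemma measurable_sabs f : smeasurable f ->
  measurable_fun setT (fun w => sabs (f w)).
Proof.
move=> [mr mi].
rewrite (_ : (fun _ => _) =
  (fun w => (sre (f w) ^+ 2 + sim (f w) ^+ 2) `^ 2^-1)); last first.
  by apply/funext => w; rewrite sabsE powR12_sqrt// addr_ge0// sqr_ge0.
apply: (@measurableT_comp _ _ _ _ _ _ (@powR R ^~ 2^-1)).
  exact: measurable_powR.
by apply: measurable_funD; apply: measurable_funX.
Qed.

Lemma smeasurableZD a f g : smeasurable f -> smeasurable g ->
  smeasurable (a *: f + g).
Proof.
move=> [fr fi] [gr gi]; split.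
  rewrite (_ : (fun _ => _) = (fun w => sre a * sre (f w) - sim a * sim (f w))
    \+ (fun w => sre (g w))); last first.
    by apply/funext => w /=; rewrite sreD sreM.
  apply: measurable_funD => //; apply: measurable_funB;
    exact: measurable_funM.
rewrite (_ : (fun _ => _) = (fun w => sre a * sim (f w) + sim a * sre (f w))
    \+ (fun w => sim (g w))); last first.
  by apply/funext => w /=; rewrite simD simM.
apply: measurable_funD => //; apply: measurable_funD;
  exact: measurable_funM.
Qed.

Definition sintegrable : {pred Omega -> K} :=
  mem [set f : Omega -> K | smeasurable f /\
    (\int[lambda]_w (sabs (f w))%:E < +oo)%E].

Lemma sintegrableP f : reflect (smeasurable f /\
    (\int[lambda]_w (sabs (f w))%:E < +oo)%E) (f \in sintegrable).
Proof. by apply: (iffP idP) => [/set_mem|/mem_set]. Qed.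

Lemma integral_sabsZD a f g : smeasurable f -> smeasurable g ->
  (\int[lambda]_w (sabs (a *: f w + g w))%:E <=
   (sabs a)%:E * \int[lambda]_w (sabs (f w))%:E +
   \int[lambda]_w (sabs (g w))%:E)%E.
Proof.
move=> mf mg.
have mf' := measurable_sabs mf; have mg' := measurable_sabs mg.
rewrite -ge0_integralZl//; last 3 first.
- exact/measurable_EFinP.
- by move=> w _; rewrite lee_fin sabs_ge0.
- by rewrite lee_fin sabs_ge0.
rewrite -ge0_integralD//; last 4 first.
- by move=> w _; rewrite mule_ge0// lee_fin sabs_ge0.
- by apply/measurable_EFinP; apply: measurable_funM.
- by move=> w _; rewrite lee_fin sabs_ge0.
- exact/measurable_EFinP.
apply: ge0_le_integral => //.
- by move=> w _; rewrite lee_fin sabs_ge0.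
- by apply/measurable_EFinP; apply: (measurable_sabs (smeasurableZD a mf mg)).
- apply/measurable_EFinP; apply: measurable_funD => //.
  exact: measurable_funM.
- by move=> w _; rewrite lee_fin (le_trans (sabsD _ _))// lerD2r sabsM.
Qed.

Let sintegrable_submod : submod_closed sintegrable.
Proof.
split=> [|a f g /sintegrableP[mf fi] /sintegrableP[mg gi]]; apply/sintegrableP.
  split; first by split; rewrite (_ : (fun _ => _) = cst 0)//;
    apply/funext => w /=; case: (k).
  by under eq_integral do rewrite sabs0; rewrite integral0 ltry.
split; first exact: smeasurableZD.
apply: (le_lt_trans (integral_sabsZD a mf mg)).
rewrite lte_add_pinfty// lte_mul_pinfty// lee_fin sabs_ge0//.
Qed.

HB.instance Definition _ :=
  GRing.isSubmodClosed.Build K (Omega -> K) sintegrable sintegrable_submod.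

Record preL1 : Type := PreL1 {
  preL1_fun :> Omega -> K;
  _ : preL1_fun \in sintegrable }.

HB.instance Definition _ := [isSub for preL1_fun].
HB.instance Definition _ := [Choice of preL1 by <:].
HB.instance Definition _ := [SubChoice_isSubLmodule of preL1 by <:].

Lemma preL1P (f : preL1) : smeasurable f /\
  (\int[lambda]_w (sabs (f w))%:E < +oo)%E.
Proof. by apply/sintegrableP; case: f. Qed.

Lemma preL1_funZD a (f g : preL1) w : (a *: f + g) w = a * f w + g w.
Proof. by rewrite -[preL1_fun (a *: f + g)]/(val (a *: f + g)) linearP. Qed.

Definition ae_null : {pred preL1} :=
  mem [set f : preL1 | {ae lambda, forall w, f w = 0}].

Lemma ae_nullP (f : preL1) :
  reflect {ae lambda, forall w, f w = 0} (f \in ae_null).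
Proof. by apply: (iffP idP) => [/set_mem|/mem_set]. Qed.

Let ae_null_submod : submod_closed ae_null.
Proof.
split=> [|a f g /ae_nullP f0 /ae_nullP g0]; apply/ae_nullP; first exact: aeW.
by apply: filterS2 f0 g0 => w fw gw; rewrite preL1_funZD fw gw mulr0 addr0.
Qed.

HB.instance Definition _ :=
  GRing.isSubmodClosed.Build K preL1 ae_null ae_null_submod.

Definition L1 : Type := lquot ae_null.

HB.instance Definition _ := GRing.Lmodule.on L1.
HB.instance Definition _ := EqQuotient.on L1.

Definition L1_fun (f : L1) : Omega -> K := preL1_fun (repr f).

Definition L1_norm (f : L1) : K :=
  sreal k (fine (\int[lambda]_w (sabs (L1_fun f w))%:E)).

Lemma L1_funP (f : L1) : smeasurable (L1_fun f) /\
  (\int[lambda]_w (sabs (L1_fun f w))%:E < +oo)%E.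
Proof. exact: preL1P. Qed.

Let repr_ae (f : preL1) (F : L1) : qmap ae_null f = F ->
  {ae lambda, forall w, L1_fun F w = f w}.
Proof.
move=> fF; have /lquot_eqP/ae_nullP : \pi_(lquot ae_null) (repr F) =
  \pi_(lquot ae_null) f by rewrite reprK -fF.
by apply: filterS => w /= /eqP; rewrite subr_eq0 => /eqP.
Qed.

Lemma L1_funZD a (f g : L1) :
  {ae lambda, forall w, L1_fun (a *: f + g) w = a * L1_fun f w + L1_fun g w}.
Proof.
apply: (@repr_ae (a *: repr f + repr g)).
by rewrite linearP; congr (_ *: _ + _); exact: reprK.
Qed.

Let I (f : L1) : \bar R := (\int[lambda]_w (sabs (L1_fun f w))%:E)%E.

Let I_ge0 f : (0 <= I f)%E.
Proof. by apply: integral_ge0 => w _; rewrite lee_fin sabs_ge0. Qed.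

Let I_fin f : I f \is a fin_num.
Proof. by rewrite ge0_fin_numE// (L1_funP f).2. Qed.

Let IZD a f g : (I (a *: f + g)%R <= (sabs a)%:E * I f + I g)%E.
Proof.
have [mf _] := L1_funP f; have [mg _] := L1_funP g.
apply: le_trans (integral_sabsZD a mf mg).
rewrite le_eqVlt; apply/orP; left; apply/eqP; apply: ge0_ae_eq_integral => //.
- by apply/measurable_EFinP; apply: measurable_sabs; apply: (L1_funP _).1.
- by apply/measurable_EFinP; apply: (measurable_sabs (smeasurableZD a mf mg)).
- by move=> w _; rewrite lee_fin sabs_ge0.
- by move=> w _; rewrite lee_fin sabs_ge0.
- by apply: filterS (L1_funZD a f g) => w -> _.
Qed.

Let I0 : I 0 = 0%E.
Proof.
rewrite -[RHS](@integral0 _ _ _ lambda setT); apply: ge0_ae_eq_integral => //.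
- by apply/measurable_EFinP; apply: measurable_sabs; apply: (L1_funP _).1.
- by move=> w _; rewrite lee_fin sabs_ge0.
apply: filterS (@repr_ae 0 0 (linear0 _)) => w -> _.
by rewrite sabs0.
Qed.

Let sabs1 : sabs (1 : K) = 1.
Proof. by rewrite /sabs normr1; case: (k). Qed.

Let L1_normD f g : L1_norm (f + g) <= L1_norm f + L1_norm g.
Proof.
rewrite -[L1_norm _]/(sreal k (fine (I (f + g)))).
rewrite -[L1_norm f]/(sreal k (fine (I f))).
rewrite -[L1_norm g]/(sreal k (fine (I g))).
rewrite -srealD sreal_le -(fineD (I_fin f) (I_fin g)).
apply: fine_le.
- exact: I_fin.
- by rewrite (fin_numD (I f) (I g)) !I_fin.
- by have := IZD 1 f g; rewrite scale1r sabs1 mul1e.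
Qed.

Let IZle a f : (I (a *: f)%R <= (sabs a)%:E * I f)%E.
Proof. by have := IZD a f 0; rewrite addr0 I0 adde0. Qed.

Let L1_normZ a f : L1_norm (a *: f) = `|a| * L1_norm f.
Proof.
rewrite -[L1_norm _]/(sreal k (fine (I (a *: f)))).
rewrite -[L1_norm f]/(sreal k (fine (I f))).
rewrite -sreal_sabs -srealM; congr (sreal k _).
rewrite -[sabs a]/(fine (sabs a)%:E) -fineM ?I_fin//; congr fine.
apply/eqP; rewrite eq_le IZle/=.
have [->|a0] := eqVneq a 0; first by rewrite sabs0 mul0e I_ge0.
have sa0 : 0 < sabs a by rewrite lt_def sabs_ge0 sabs_eq0 a0.
rewrite muleC -lee_pdivlMr//.
have -> : (sabs a)^-1 = sabs a^-1.
  by apply: (mulfI (lt0r_neq0 sa0)); rewrite -sabsM !divff// ?gt_eqF.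
by rewrite muleC -{1}[f](scalerK a0); apply: IZle.
Qed.

Let L1_norm_eq0 f : L1_norm f = 0 -> f = 0.
Proof.
rewrite /L1_norm -(@sreal0 R k) => /(can_inj srealK)/eqP.
rewrite fine_eq0 ?I_fin// => /eqP If0.
rewrite -[f]reprK; apply/qmap_eq0/ae_nullP.
have [mf _] := L1_funP f.
have /ae_eq_integral_abs :
    measurable_fun setT (EFin \o (fun w => sabs (L1_fun f w))).
  by apply/measurable_EFinP; apply: measurable_sabs.
move=> /(_ lambda measurableT)[+ _].
have -> : (\int[lambda]_x `|(EFin \o (fun w => sabs (L1_fun f w))) x| = 0)%E.
  rewrite -[RHS]If0; apply: eq_integral => w _.
  by rewrite gee0_abs// lee_fin sabs_ge0.
move=> /(_ erefl); apply: filterS => w /= /(_ Logic.I) [] /eqP.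
by rewrite sabs_eq0 => /eqP.
Qed.

HB.instance Definition _ := Lmodule_isNormed.Build K L1
  L1_normD L1_normZ L1_norm_eq0.

(* L1 with the topology of convergence in measure: the ball of radius e around
   f is [measure_ball f e]; see [cvg_L1_in_measureP]. *)
Definition L1_in_measure : Type := L1.

HB.instance Definition _ := Choice.on L1_in_measure.

Definition measure_ball (f : L1_in_measure) (e : R) (g : L1_in_measure) :
    Prop :=
  (lambda [set w | e <= sabs (L1_fun f w - L1_fun g w)]%R < e%:E)%E.

Let measurable_dist (f g : L1) e :
  measurable [set w | e <= sabs (L1_fun f w - L1_fun g w)].
Proof.
have mfg := measurable_sabs
  (smeasurableZD (-1) (L1_funP g).1 (L1_funP f).1).
rewrite (_ : [set _ | _] = setT `&`
  (fun w => sabs ((-1 *: L1_fun g + L1_fun f) w)) @^-1` `[e, +oo[%classic); first exact: mfg.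
apply/seteqP; split=> w /=; rewrite in_itv/= andbT scaleN1r addrC//.
by case.
Qed.

Let measure_ball_center f e : 0 < e -> measure_ball f e f.
Proof.
move=> e0; rewrite /measure_ball (_ : [set _ | _] = set0) ?measure0//.
by apply/seteqP; split=> w //=; rewrite subrr sabs0 leNgt e0.
Qed.

Let measure_ball_sym f g e : measure_ball f e g -> measure_ball g e f.
Proof.
rewrite /measure_ball (_ : [set _ | _] =
  [set w | e <= sabs (L1_fun g w - L1_fun f w)])//.
by apply/seteqP; split=> w /=; rewrite -sabsN opprB.
Qed.

Let measure_ball_triangle f g h e1 e2 :
  measure_ball f e1 g -> measure_ball g e2 h -> measure_ball f (e1 + e2) h.
Proof.
move=> fg gh; rewrite /measure_ball EFinD; apply: le_lt_trans (lteD fg gh).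
apply: le_trans (measureU2 _ _ _) => //.
apply: le_measure; rewrite ?inE//; first exact: measurableU.
move=> w /= h12.
have [?|lt1] := leP e1 (sabs (L1_fun f w - L1_fun g w)); [by left|right].
rewrite leNgt; apply/negP => lt2; move: h12; rewrite leNgt => /negP; apply.
rewrite -(subrK (L1_fun g w) (L1_fun f w)) -addrA.
by rewrite (le_lt_trans (sabsD _ _))// ltrD.
Qed.

HB.instance Definition _ := hasNbhs.Build L1_in_measure
  (nbhs_ (entourage_ measure_ball)).
HB.instance Definition _ := @Nbhs_isPseudoMetric.Build R L1_in_measure
  (entourage_ measure_ball) erefl measure_ball measure_ball_center
  measure_ball_sym measure_ball_triangle erefl.

Lemma cvg_L1_in_measureP (u : nat -> L1_in_measure) (f : L1_in_measure) :
  u n @[n --> \oo] --> f <->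
  forall e : R, 0 < e ->
    lambda [set w | e <= sabs (L1_fun (u n) w - L1_fun f w)] @[n --> \oo]
      --> 0%E.
Proof.
have fin (A : set Omega) : measurable A -> lambda A \is a fin_num.
  exact: fin_num_measure.
split=> [uf e e0|h].
  apply/fine_cvgP; split; first by near=> n; exact: fin.
  apply/cvgrPdist_lt => del del0.
  have m0 : 0 < Num.min e del by rewrite lt_min e0.
  have /(_ _ _ m0) := cvg_ball uf; apply: filterS => n un.
  have {}un := measure_ball_sym un.
  rewrite sub0r normrN ger0_norm ?fine_ge0//.
  rewrite -lte_fin fineK ?fin//.
  apply: (@lt_le_trans _ _ (Num.min e del)%:E); last first.
    by rewrite lee_fin ge_min lexx orbT.
  apply: le_lt_trans un; apply: le_measure; rewrite ?inE//.
  by move=> w /=; apply: le_trans; rewrite ge_min lexx.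
apply/cvg_ballP => e e0.
have /fine_cvgP[_ /cvgrPdist_lt/(_ e e0)] := h _ e0.
apply: filterS => n; rewrite sub0r normrN ger0_norm ?fine_ge0// => un.
apply: measure_ball_sym.
by rewrite /measure_ball -(fineK (fin _ (measurable_dist _ _ _))) lte_fin.
Unshelve. all: by end_near. Qed.

Definition C_ (X : submodClosed L1) : set L1 :=
  closure ([set f : L1 | f \in X /\ unit_ball L1 f] : set L1_in_measure).

Lemma C_P (X : submodClosed L1) (f : L1) :
  C_ X f <-> forall e : R, 0 < e ->
    exists g, [/\ g \in X, unit_ball L1 g & measure_ball f e g].
Proof.
split=> [Xf e e0|h A /nbhs_ballP[e /= e0 fA]].
  by have [g [[gX g1] fg]] := Xf _ (nbhsx_ballx (f : L1_in_measure) e e0);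
    exists g.
by have [g [gX g1 fg]] := h e e0; exists g; split=> //; exact: fA.
Qed.

End L1.

(* Main.v *)
(* Approximate y by v using narrowness twice, against the constants 1 and -1.
   Then ||1 + v|| and ||-1 + v|| are both nearly 2, which forces v to be small
   in measure, while y - v is nearly in X and has norm at most 2.  Hence
   (y - v) / 2 is nearly in B(X) and close to y / 2 in measure. *)

From HB Require Import structures.
Require Import Defs.
From mathcomp Require Import all_boot all_order all_algebra.
From mathcomp Require Import all_classical all_reals all_analysis.
From mathcomp Require Import generic_quotient complex.
From mathcomp Require Import ring lra measurable_realfun.

Set Implicit Arguments.
Unset Strict Implicit.
Unset Printing Implicit Defensive.

Import Order.TTheory GRing.Theory Num.Theory.
Import numFieldTopology.Exports numFieldNormedType.Exports.

Local Open Scope classical_set_scope.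
Local Open Scope ring_scope.

(** * Scalars through their real and imaginary parts, and the two-point inequality *)

Section Scalars.
Context {R : realType} {k : scalar_kind}.
Local Notation K := (scalars R k).
Implicit Types (z w a : K) (x y e : R).

Lemma scalar_eq z w : sre z = sre w -> sim z = sim w -> z = w.
Proof. by case: k z w => //= -[? ?] [? ?] /= -> ->. Qed.

Lemma sreN z : sre (- z) = - sre z.
Proof. by case: k z => //= -[]. Qed.

Lemma simN z : sim (- z) = - sim z.
Proof. by case: k z => /= [z|[]//]; rewrite oppr0. Qed.

Lemma sre1 : sre (1 : K) = 1.
Proof. by case: k. Qed.

Lemma sim1 : sim (1 : K) = 0.
Proof. by case: k. Qed.

Lemma sre_real x : sre (sreal k x) = x.
Proof. exact: srealK. Qed.

Lemma sim_real x : sim (sreal k x) = 0.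
Proof. by case: k. Qed.

Lemma sreal1 : sreal k (1 : R) = 1.
Proof. by case: k. Qed.

Lemma srealN x : sreal k (- x) = - sreal k x.
Proof. by apply: scalar_eq; rewrite ?sreN ?simN ?sre_real ?sim_real ?oppr0. Qed.

Lemma sreal2 : sreal k (2 : R) = 2.
Proof. by rewrite -[2]/(1 + 1) srealD sreal1. Qed.

Lemma sreal_half : sreal k (2^-1 : R) = 2^-1.
Proof.
apply: (@mulfI _ 2); first by rewrite pnatr_eq0.
by rewrite mulfV ?pnatr_eq0// -sreal2 -srealM mulfV ?pnatr_eq0// sreal1.
Qed.

Lemma sabs_real x : sabs (sreal k x) = `|x|.
Proof. by rewrite sabsE sre_real sim_real expr0n addr0 sqrtr_sqr. Qed.

Lemma sabs1 : sabs (1 : K) = 1.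
Proof. by rewrite -sreal1 sabs_real normr1. Qed.

Lemma sqr_sabs z : sabs z ^+ 2 = sre z ^+ 2 + sim z ^+ 2.
Proof. by rewrite sabsE sqr_sqrtr// addr_ge0// sqr_ge0. Qed.

Lemma sre_le_sabs z : `|sre z| <= sabs z.
Proof.
by rewrite sabsE -sqrtr_sqr ler_sqrt ?addr_ge0 ?sqr_ge0// lerDl sqr_ge0.
Qed.

Lemma sim_le_sabs z : `|sim z| <= sabs z.
Proof.
by rewrite sabsE -sqrtr_sqr ler_sqrt ?addr_ge0 ?sqr_ge0// lerDr sqr_ge0.
Qed.

Lemma sabs_le_normD z : sabs z <= `|sre z| + `|sim z|.
Proof.
rewrite -[leRHS]ger0_norm ?addr_ge0// -sqrtr_sqr sabsE ler_sqrt ?sqr_ge0//.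
rewrite -(real_normK (num_real (sre z))) -(real_normK (num_real (sim z))).
have := normr_ge0 (sre z); have := normr_ge0 (sim z).
by move: `|_| `|_| => a b; nra.
Qed.

(** Over the reals the second argument is dropped, so that one formula serves both kinds of
    scalars. *)
Definition smake x y : K :=
  match k as k return scalars R k with
  | RealScalars => x
  | ComplexScalars => Complex x y
  end.

Lemma sre_make x y : sre (smake x y) = x.
Proof. by rewrite /smake; case: k. Qed.

Definition sconj z : K := smake (sre z) (- sim z).

Lemma sre_conj z : sre (sconj z) = sre z.
Proof. exact: sre_make. Qed.

Lemma sim_conj z : sim (sconj z) = - sim z.
Proof. by rewrite /sconj /smake; case: k z => //= z; rewrite oppr0. Qed.

Lemma sabs_conj z : sabs (sconj z) = sabs z.
Proof. by rewrite !sabsE sre_conj sim_conj sqrrN. Qed.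

(* By the parallelogram law the mean of |1 + z| and |-1 + z| is at most
   sqrt (1 + |z|^2), which is smaller than 1 + |z| unless z is small. *)
Lemma sabs_two_points z :
  sabs z / (1 + sabs z) + (sabs (1 + z) + sabs (-1 + z)) / 2 <= 1 + sabs z.
Proof.
have t0 := sabs_ge0 z; have p0 := sabs_ge0 (1 + z).
have q0 := sabs_ge0 (-1 + z).
have : sabs (1 + z) ^+ 2 + sabs (-1 + z) ^+ 2 = 2 + 2 * sabs z ^+ 2.
  rewrite !sqr_sabs !sreD !simD !sreN !simN sre1 sim1; ring.
move: (sabs z) (sabs (1 + z)) (sabs (-1 + z)) t0 p0 q0 => t p q t0 p0 q0 pq.
have t1 : 0 < 1 + t by lra.
rewrite -(ler_pM2l t1) mulrDr mulrCA divff ?gt_eqF// mulr1.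
(* Both sides are nonnegative, so squares can be compared; with the mean squared bounded by
   [1 + t ^+ 2], the remaining gap is exactly [t ^+ 2]. *)
suff : (1 + t) * ((p + q) / 2) <= 1 + t + t ^+ 2 by nra.
rewrite -ler_sqr ?nnegrE; last 2 first.
- by rewrite mulr_ge0 ?divr_ge0 ?addr_ge0// ltW.
- by rewrite !addr_ge0// sqr_ge0.
have mean : ((p + q) / 2) ^+ 2 <= 1 + t ^+ 2.
  rewrite -subr_ge0 (_ : _ - _ = ((p - q) / 2) ^+ 2) ?sqr_ge0//.
  rewrite (_ : t ^+ 2 = (p ^+ 2 + q ^+ 2) / 2 - 1); first by field.
  by rewrite pq; field.
rewrite exprMn (le_trans (ler_wpM2l _ mean)) ?sqr_ge0//.
by rewrite -subr_ge0 (_ : _ - _ = t ^+ 2) ?sqr_ge0//; ring.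
Qed.

(** The function [t / (1 + t)] is increasing, and moving from [t] to [s + t] raises it by at most
    [s]; hence [e <= s + t] gives [e / (1 + e) <= s + t / (1 + t)], and [sabs_two_points] does the
    rest. In the application [w] is a difference of two functions at a point where it is large, [z]
    is the value of [v], and [a] is a small error. *)
Lemma sabs_two_points_far e z a w : 0 < e -> e <= sabs w ->
  sabs w <= sabs a + sabs z ->
  e / (1 + e) + (sabs (1 + z) + sabs (-1 + z)) / 2 <= sabs a + (1 + sabs z).
Proof.
move=> e0 ew waz; have := sabs_two_points z.
have : e / (1 + e) <= sabs a + sabs z / (1 + sabs z).
  have a0 := sabs_ge0 a; have t0 := sabs_ge0 z.
  have : e <= sabs a + sabs z by lra.
  move: (sabs a) (sabs z) a0 t0 => s t s0 t0 est.
  have -> : s + t / (1 + t) = (s * (1 + t) + t) / (1 + t) by field; lra.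
  rewrite ler_pdivrMr; last lra.
  rewrite mulrAC ler_pdivlMr; last lra.
  have st : 0 <= s * t by exact: mulr_ge0.
  have := mulr_ge0 st (ltW e0); have := mulr_ge0 s0 (ltW e0); nra.
lra.
Qed.

(** Two triangle inequalities; this handles the points where the difference is small. *)
Lemma sabs_two_points_ge0 z : sabs (1 + z) + sabs (-1 + z) <= 2 * (1 + sabs z).
Proof.
have := sabsD 1 z; have := sabsD (-1) z; rewrite sabsN sabs1; lra.
Qed.

(** Separates the real from the complex case without destructing [k], on which the type of [L1]
    depends. *)
Lemma sim_make_cases :
  (forall z, sim z = 0) \/ (forall x y, sim (smake x y) = y).
Proof. by rewrite /smake; case: k; [left|right]. Qed.

End Scalars.
Arguments sreal2 : clear implicits.
Arguments sim_make_cases : clear implicits.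

(** * Norms as real numbers *)

Section RealNorm.
Context {R : realType} {k : scalar_kind} {W : normedModType (scalars R k)}.
Implicit Types (u v : W) (x : R).

(** The norm of [W] takes values in the scalars; the real copy makes estimates accessible to
    [lra]. *)
Definition rnorm v : R := sre `|v|.

Lemma sreal_rnorm v : sreal k (rnorm v) = `|v|.
Proof. exact: sreal_norm. Qed.

Lemma rnorm_ge0 v : 0 <= rnorm v.
Proof. by rewrite -(@sreal_le _ k) sreal_rnorm sreal0. Qed.

Lemma rnormD u v : rnorm (u + v) <= rnorm u + rnorm v.
Proof. by rewrite -(@sreal_le _ k) srealD !sreal_rnorm ler_normD. Qed.

Lemma rnormZ a v : rnorm (a *: v) = sabs a * rnorm v.
Proof.
by apply: (can_inj (@srealK R k));
  rewrite srealM !sreal_rnorm sreal_sabs normrZ.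
Qed.

Lemma rnormN v : rnorm (- v) = rnorm v.
Proof. by rewrite /rnorm normrN. Qed.

Lemma rnorm_eq0 v : (rnorm v == 0) = (v == 0).
Proof.
by rewrite -(inj_eq (can_inj (@srealK R k))) sreal_rnorm sreal0 normr_eq0.
Qed.

Lemma unit_ballE v : unit_ball W v <-> rnorm v <= 1.
Proof. by rewrite /unit_ball/= -sreal_rnorm -[X in _ <= X]sreal1 sreal_le. Qed.

Lemma unit_sphereE v : unit_sphere W v <-> rnorm v = 1.
Proof.
rewrite /unit_sphere/= -sreal_rnorm -[X in _ = X]sreal1.
by split=> [/(can_inj srealK)|->].
Qed.

End RealNorm.

(** * Narrow operators and slices *)

Section Narrow.
Context {R : realType} {k : scalar_kind}.
Local Notation K := (scalars R k).

Lemma narrow_real (W V : normedModType K) (T : {linear W -> V}) (x y : W)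
    (e : R) (S : set W) :
  narrow T -> rnorm x = 1 -> rnorm y = 1 -> 0 < e -> slice S -> S y ->
  exists v, [/\ S v, 2 - e < rnorm (x + v) & rnorm (T (y - v)) < e].
Proof.
move=> nT /unit_sphereE x1 /unit_sphereE y1 e0 sS Sy.
have ke0 : 0 < sreal k e by rewrite -(@sreal0 R k) sreal_lt.
have [v [Sv xv Tv]] := nT x y _ S x1 y1 ke0 sS Sy.
exists v; split=> //; rewrite -(@sreal_lt _ k) sreal_rnorm//.
by rewrite srealD srealN sreal2.
Qed.

Lemma slice_unit_ball (W : normedModType K) : slice (unit_ball W).
Proof.
split; first by exists 0; rewrite /unit_ball/= normr0.
(* The zero functional exceeds any negative threshold, so this slice is the whole ball. *)
exists (\0 : {linear W -> K^o}), (-1); split; first exact: cst_continuous.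
apply/seteqP; split=> w /=; last by case.
by move=> ?; split=> //; case: k => /=; rewrite ltrN10.
Qed.

(* The slice requirement makes the two conditions hold for one vector: the
   first approximation of y is normed together with x by some functional, and
   staying in its slice preserves the first condition. *)
Lemma narrow_two_points (W V : normedModType K) (T : {linear W -> V})
    (x z y : W) (e : R) :
  (forall u : W, exists phi : {linear W -> K^o},
    [/\ continuous phi, forall w, sre (phi w) <= rnorm w &
        sre (phi u) = rnorm u]) ->
  (forall w, rnorm (T w) <= rnorm w) ->
  narrow T -> rnorm x = 1 -> rnorm z = 1 -> rnorm y = 1 -> 0 < e < 1 ->
  exists v, [/\ rnorm v <= 1, 2 - 4 * e < rnorm (x + v),
    2 - 4 * e < rnorm (z + v) & rnorm (T (y - v)) < 3 * e].
Proof.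
move=> norming T1 nT x1 z1 y1 /andP[e0 e1].
have [|v [/unit_ballE v1 xv Tv]] :=
  narrow_real nT x1 y1 e0 (slice_unit_ball W).
  by apply/unit_ballE; rewrite y1.
have ve : 1 - e < rnorm v by have := rnormD x v; lra.
(* Here [e < 1] matters. Narrowness approximates only unit vectors, so [v] has to be normalized
   before its second use. *)
have v0 : 0 < rnorm v by lra.
pose c := (rnorm v)^-1; pose v' := sreal k c *: v.
have v'1 : rnorm v' = 1.
  by rewrite /v' rnormZ sabs_real ger0_norm ?invr_ge0 ?ltW// mulVf// gt_eqF.
have vv' : rnorm (v - v') < e.
  rewrite (_ : v - v' = sreal k (1 - c) *: v); last first.
    by rewrite srealD srealN sreal1 scalerBl scale1r.
  rewrite rnormZ sabs_real ler0_norm; last first.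
    by rewrite subr_le0 /c -[leLHS]invr1 lef_pV2// posrE.
  by rewrite opprB mulrBl mul1r mulVf ?gt_eqF//; lra.
(* Both [phi x] and [phi v'] have real part at most 1, while the sum exceeds [2 - 2 * e]; hence each
   exceeds [1 - 2 * e]. *)
have [phi [cphi phile phiE]] := norming (x + v').
have xv' : 2 - 2 * e < rnorm (x + v').
  have := rnormD (x + v') (v - v').
  rewrite (_ : x + v' + (v - v') = x + v); first by lra.
  by rewrite addrACA subrr addr0.
have phix := phile x; have phiv := phile v'.
have phiD w : sre (phi (x + w)) = sre (phi x) + sre (phi w).
  by rewrite linearD sreD.
pose S := [set w | unit_ball W w /\ 1 - 2 * e < sre (phi w)].
have Sv' : S v'.
  split; first by apply/unit_ballE; rewrite v'1.
  by have := phiD v'; lra.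
have sS : slice S by split; [exists v'|exists phi, (1 - 2 * e)].
have [w [[/unit_ballE w1 phiw] zw Tw]] := narrow_real nT z1 v'1 e0 sS Sv'.
exists w; split=> //.
(* Each of [phi x] and [phi w] loses at most [2 * e], whence the bound [2 - 4 * e]. *)
- by have := phile (x + w); rewrite phiD; have := phiD v'; lra.
- lra.
(* One [e] for each approximation and one for the normalization. *)
have -> : T (y - w) = T (y - v) + T (v - v') + T (v' - w).
  by rewrite -!linearD/=; congr (T _); rewrite !addrA !subrK.
have := rnormD (T (y - v) + T (v - v')) (T (v' - w)).
have := rnormD (T (y - v)) (T (v - v')); have := T1 (v - v'); lra.
Qed.

(** * The quotient norm *)

Context {V : normedModType K} {Z : submodClosed V} (clZ : closed [set` Z]).

Lemma rnorm_quotient (v : V) : rnorm (quotient_map clZ v) =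
  inf [set rnorm u | u in [set u | qmap Z u = qmap Z v]].
Proof. by rewrite /rnorm -[RHS](@sre_real _ k). Qed.

Lemma rnorm_quotient_le (v : V) : rnorm (quotient_map clZ v) <= rnorm v.
Proof.
rewrite rnorm_quotient; apply: ge_inf; last by exists v.
by exists 0 => _ [u _ <-]; exact: rnorm_ge0.
Qed.

(** The infimum over the coset of [v] is below [e], so some [u] in that coset has norm below [e];
    take [z] to be [v - u]. *)
Lemma rnorm_quotient_lt (v : V) (e : R) : rnorm (quotient_map clZ v) < e ->
  exists2 z, z \in Z & rnorm (v - z) < e.
Proof.
rewrite rnorm_quotient => /inf_lt[|_ [u uv <-] ue].
  by exists (rnorm v), v.
exists (v - u); last by rewrite subKr.
by apply/(@qmap_eq0 _ _ Z); rewrite linearB/= uv subrr.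
Qed.

End Narrow.

(** * Representatives of classes and the constant function 1 *)

Section L1.
Context {d : measure_display} {Omega : measurableType d} {R : realType}.
Context (lambda : probability Omega R) (k : scalar_kind).
Local Notation K := (scalars R k).
Local Notation L1 := (L1 lambda k).
Local Notation null := (@ae_null _ _ _ lambda k).
Implicit Types (f g u v : L1).

Lemma integral_cst_probability (x : R) : (\int[lambda]_w x%:E = x%:E)%E.
Proof. by rewrite integral_cst//= probability_setT mule1. Qed.

Lemma measurable_sabs_L1 f :
  measurable_fun setT (EFin \o (fun w => sabs (L1_fun f w))).
Proof.
by apply/measurable_EFinP; apply: measurable_sabs; exact: (L1_funP f).1.
Qed.

Lemma rnorm_L1 f : (rnorm f)%:E = (\int[lambda]_w (sabs (L1_fun f w))%:E)%E.
Proof.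
rewrite -[rnorm f]/(sre (L1_norm f)) /L1_norm sre_real fineK//.
rewrite ge0_fin_numE; first exact: (L1_funP f).2.
by apply: integral_ge0 => w _; rewrite lee_fin sabs_ge0.
Qed.

Lemma L1_fun_qmap (p : preL1 lambda k) :
  {ae lambda, forall w, L1_fun (qmap null p : L1) w = p w}.
Proof.
set F : L1 := qmap null p.
have /ae_nullP : repr F - p \in null.
  apply/(@qmap_eq0 _ _ null)/eqP; rewrite linearB subr_eq0; apply/eqP.
  exact: reprK.
by apply: filterS => w /= /eqP; rewrite subr_eq0 => /eqP.
Qed.

(** The chosen representative of the class of the constant 1 equals 1 only almost everywhere. *)
Lemma L1_one : exists f, {ae lambda, forall w, L1_fun f w = 1}.
Proof.
have i1 : (fun=> 1 : K) \in @sintegrable _ _ _ lambda k.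
  apply/sintegrableP; split; first by split; exact: measurable_cst.
  by under eq_integral do rewrite sabs1; rewrite integral_cst_probability ltry.
by exists (qmap null (PreL1 i1)); exact: L1_fun_qmap (PreL1 i1).
Qed.

Lemma rnorm_L1_one f : {ae lambda, forall w, L1_fun f w = 1} -> rnorm f = 1.
Proof.
move=> f1; apply: EFin_inj; rewrite rnorm_L1.
rewrite -[RHS]integral_cst_probability.
apply: ae_eq_integral => //; first exact: measurable_sabs_L1.
by apply: filterS f1 => w -> _; rewrite sabs1.
Qed.

(** * Functionals given by integration against a function bounded by 1 *)

Section Pairing.
Context (h : Omega -> K) (mh : smeasurable h) (h1 : forall w, sabs (h w) <= 1).

Let measurable_mul f : smeasurable (fun w => h w * L1_fun f w).
Proof.
have [hr hi] := mh; have [fr fi] := (L1_funP f).1; split.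
  under eq_fun do rewrite sreM.
  by apply: measurable_funB; apply: measurable_funM.
under eq_fun do rewrite simM.
by apply: measurable_funD; apply: measurable_funM.
Qed.

Let sabs_mul f w : sabs (h w * L1_fun f w) <= sabs (L1_fun f w).
Proof. by rewrite sabsM ler_piMl ?sabs_ge0. Qed.

Let integrable_sabs f :
  lambda.-integrable setT (EFin \o (fun w => sabs (L1_fun f w))).
Proof.
apply/integrableP; split; first exact: measurable_sabs_L1.
under eq_integral do rewrite /= ger0_norm ?sabs_ge0//.
exact: (L1_funP f).2.
Qed.

(** Keeping [p] abstract lets the real and imaginary parts share one domination argument. *)
Let integrable_part (p : K -> R) f : (forall z, `|p z| <= sabs z) ->
  measurable_fun setT (fun w => p (h w * L1_fun f w)) ->
  lambda.-integrable setT (EFin \o (fun w => p (h w * L1_fun f w))).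
Proof.
move=> psabs mp; apply: le_integrable (integrable_sabs f) => //.
  exact/measurable_EFinP.
move=> w _ /=; rewrite lee_fin (ger0_norm (sabs_ge0 _)).
exact: le_trans (psabs _) (sabs_mul f w).
Qed.

Let part_le (p : K -> R) f : (forall z, `|p z| <= sabs z) ->
  measurable_fun setT (fun w => p (h w * L1_fun f w)) ->
  `|\int[lambda]_w p (h w * L1_fun f w)| <= rnorm f.
Proof.
move=> psabs mp; have ip := integrable_part psabs mp.
apply: le_trans (le_normr_Rintegral measurableT ip) _.
rewrite -lee_fin rnorm_L1 -[leRHS]fineK; last first.
  by rewrite -rnorm_L1.
rewrite lee_fin -[leRHS]/(\int[lambda]_w sabs (L1_fun f w)).
apply: le_Rintegral => //.
- exact: integrable_norm ip.
- by move=> w _; exact: le_trans (psabs _) (sabs_mul f w).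
Qed.

Let re_mul_integrable f :=
  integrable_part (@sre_le_sabs R k) (measurable_mul f).1.
Let im_mul_integrable f :=
  integrable_part (@sim_le_sabs R k) (measurable_mul f).2.

(** The scalar integral of [h] times [f], assembled from two real integrals. *)
Definition pairing (f : L1) : K^o :=
  smake (\int[lambda]_w sre (h w * L1_fun f w))
        (\int[lambda]_w sim (h w * L1_fun f w)).

Lemma sre_pairing f : sre (pairing f) = \int[lambda]_w sre (h w * L1_fun f w).
Proof. exact: sre_make. Qed.

Lemma sim_pairing f :
  sim (pairing f) = \int[lambda]_w sim (h w * L1_fun f w).
Proof.
have [kR|kC] := sim_make_cases R k; last exact: kC.
rewrite kR /Rintegral; under eq_integral do rewrite kR.
by rewrite integral0.
Qed.

(* Meant for p the real or the imaginary part, with the formula for the p-part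
   of a complex product as the first hypothesis. *)
Let part_ZD (p q r : K -> R) (a b : R) f g (c : K) :
  (forall z w, p (c * z + w) = a * q z + b * r z + p w) ->
  (forall f, measurable_fun setT (fun w => p (h w * L1_fun f w))) ->
  (forall f, lambda.-integrable setT
    (EFin \o (fun w => p (h w * L1_fun f w)))) ->
  (forall f, lambda.-integrable setT
    (EFin \o (fun w => q (h w * L1_fun f w)))) ->
  (forall f, lambda.-integrable setT
    (EFin \o (fun w => r (h w * L1_fun f w)))) ->
  \int[lambda]_w p (h w * L1_fun (c *: f + g) w) =
  a * \int[lambda]_w q (h w * L1_fun f w) +
  b * \int[lambda]_w r (h w * L1_fun f w) +
  \int[lambda]_w p (h w * L1_fun g w).
Proof.
move=> pE mp ip iq ir.
have iZ (F : Omega -> R) (x : R) : lambda.-integrable setT (EFin \o F) ->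
    lambda.-integrable setT (EFin \o (fun w => x * F w)).
  by move=> iF; exact: (@integrableZl _ _ _ _ _ _ x (EFin \o F)).
have iD (F G : Omega -> R) : lambda.-integrable setT (EFin \o F) ->
    lambda.-integrable setT (EFin \o G) ->
    lambda.-integrable setT (EFin \o (fun w => F w + G w)).
  by move=> iF iG; exact: (@integrableD _ _ _ _ _ _ (EFin \o F) (EFin \o G)).
rewrite -!RintegralZl// -!RintegralD//; last 3 first.
- by apply: iD; apply: iZ.
- exact: iZ.
- exact: iZ.
congr fine; apply: ae_eq_integral => //.
- exact/measurable_EFinP.
- have /integrableP[] := iD _ _ (iD _ _ (iZ _ a (iq f)) (iZ _ b (ir f))) (ip g).
  by [].
(* Choosing representatives is linear only up to a null set, which the integral ignores. *)
- apply: filterS (L1_funZD c f g) => w fg _; congr EFin.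
  by rewrite fg mulrDr mulrCA pE.
Qed.

Let pairing_linear : linear pairing.
Proof.
move=> c f g; apply: scalar_eq.
  rewrite sreD sreM !sre_pairing sim_pairing.
  rewrite (part_ZD (p := @sre R k) (q := @sre R k) (r := @sim R k) (a := sre c)
    (b := - sim c)) ?mulNr//.
  - by move=> z w; rewrite sreD sreM mulNr.
  - by move=> ?; exact: (measurable_mul _).1.
rewrite simD simM !sim_pairing sre_pairing.
rewrite (part_ZD (p := @sim R k) (q := @sim R k) (r := @sre R k) (a := sre c)
  (b := sim c))//.
- by move=> z w; rewrite simD simM.
- by move=> ?; exact: (measurable_mul _).2.
Qed.

Lemma pairing_functional : exists phi : {linear L1 -> K^o},
  [/\ continuous phi, forall f, sre (phi f) <= rnorm f &
      forall f, sre (phi f) = \int[lambda]_w sre (h w * L1_fun f w)].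
Proof.
pose phi : {linear L1 -> K^o} :=
  HB.pack pairing (GRing.isLinear.Build K L1 K^o *:%R pairing pairing_linear).
exists phi; split; last exact: sre_pairing.
- apply: bounded_linear_continuous; apply/linear_boundedP.
  (* The factor 2 comes from bounding the two parts separately. It suffices for continuity; the
     sharp constant 1 is proved only for the real part. *)
  near=> r => f; apply: (@le_trans _ _ (2 * `|f|)).
    rewrite -[`|_|]sreal_sabs -sreal_rnorm.
    rewrite -(sreal2 R k) -srealM sreal_le mulr2n mulrDl mul1r.
    apply: le_trans (sabs_le_normD _) _; rewrite sre_pairing sim_pairing.
    apply: lerD.
      exact: part_le (@sre_le_sabs R k) (measurable_mul f).1.
    exact: part_le (@sim_le_sabs R k) (measurable_mul f).2.
  rewrite ler_wpM2r//; near: r; apply: nbhs_pinfty_ge; rewrite num_real//.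
- move=> f; rewrite sre_pairing; apply: le_trans (ler_norm _) _.
  exact: part_le (@sre_le_sabs R k) (measurable_mul f).1.
Unshelve. all: by end_near. Qed.

End Pairing.

(** Pair with the conjugate sign of [u], that is, its conjugate divided by its modulus: the product
    with [u] is the modulus of [u]. *)
Lemma L1_norming u : exists phi : {linear L1 -> K^o},
  [/\ continuous phi, forall f, sre (phi f) <= rnorm f & sre (phi u) = rnorm u].
Proof.
(* Since [0^-1 = 0], [h] vanishes where [u] does. *)
pose h w := sreal k (sabs (L1_fun u w))^-1 * sconj (L1_fun u w).
have mu := (L1_funP u).1.
have minv : measurable_fun setT (fun w => (sabs (L1_fun u w))^-1).
  under eq_fun do rewrite -powR_inv1 ?sabs_ge0//.
  by apply: (measurableT_comp (measurable_powR _)); exact: measurable_sabs.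
have mh : smeasurable h.
  have [ur ui] := mu; split; rewrite /h.
    under eq_fun do rewrite sreM sre_real sim_real mul0r subr0 sre_conj.
    exact: measurable_funM.
  under eq_fun do rewrite simM sre_real sim_real mul0r addr0 sim_conj.
  by apply: measurable_funM => //; exact: measurable_funN.
have h1 w : sabs (h w) <= 1.
  rewrite /h sabsM sabs_conj sabs_real.
  have [->|u0] := eqVneq (sabs (L1_fun u w)) 0; first by rewrite mulr0.
  by rewrite ger0_norm ?invr_ge0 ?sabs_ge0// mulVf.
have [phi [cphi phile phiE]] := pairing_functional mh h1.
exists phi; split=> //; rewrite phiE; apply: EFin_inj; rewrite rnorm_L1.
rewrite -[RHS]fineK; last by rewrite -rnorm_L1.
congr EFin; congr fine; apply: eq_integral => w _; congr EFin.
rewrite /h -mulrA sreM sre_real sim_real mul0r subr0 sreM sre_conj sim_conj.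
rewrite mulNr opprK -!expr2 -sqr_sabs.
have [->|u0] := eqVneq (sabs (L1_fun u w)) 0; first by rewrite invr0 mul0r.
by rewrite expr2 mulKf.
Qed.

(** * Integrating the two-point inequality *)

Lemma measurable_dist_ge f g (e : R) :
  measurable [set w | e <= sabs (L1_fun f w - L1_fun g w)].
Proof.
have mfg := measurable_sabs
  (smeasurableZD (-1) (L1_funP g).1 (L1_funP f).1).
rewrite (_ : [set _ | _] = setT `&`
  (fun w => sabs ((-1 *: L1_fun g + L1_fun f) w)) @^-1` `[e, +oo[%classic).
  exact: mfg.
by rewrite setTI; apply/seteqP; split=> w /=;
  rewrite in_itv/= andbT scaleN1r addrC.
Qed.

(** A Chebyshev-type estimate: each point where [f] and [g] are [e] apart contributes at least
    [e / (1 + e)] to the gap between the two integrands. If [one + v] and [- one + v] both have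
    nearly maximal norm and the error [f - g - s *: v] is small, few such points exist. *)
Lemma L1_two_points (one f g v : L1) (s : K) (e : R) :
  {ae lambda, forall w, L1_fun one w = 1} -> 0 < e -> sabs s <= 1 ->
  (lambda [set w | e <= sabs (L1_fun f w - L1_fun g w)]%R *
     (e / (1 + e))%R%:E +
   ((rnorm (one + v) + rnorm (- one + v)) / 2)%R%:E <=
   (rnorm (f - g - s *: v) + (1 + rnorm v))%R%:E)%E.
Proof.
move=> one1 e0 s1; set D := [set w | _]; set a := f - g - s *: v.
have mD : measurable D := measurable_dist_ge f g e.
have e1 : 0 <= e / (1 + e) by rewrite divr_ge0 ?addr_ge0// ltW.
have ms u := measurable_sabs_L1 u.
have mr (F : Omega -> R) : measurable_fun setT (EFin \o F) ->
  measurable_fun setT F by move/measurable_EFinP.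
have s0 u w : (0 <= (sabs (L1_fun u w))%:E)%E by rewrite lee_fin sabs_ge0.
(* [A] and [B] are the integrands of the norm terms on the left and right. *)
pose A w := (sabs (L1_fun (one + v) w) + sabs (L1_fun (- one + v) w)) / 2.
pose B w := sabs (L1_fun a w) + (1 + sabs (L1_fun v w)).
have mA : measurable_fun setT A.
  apply: measurable_funM => //; apply: measurable_funD; exact/mr/ms.
have mB : measurable_fun setT B.
  apply: measurable_funD; first exact/mr/ms.
  by apply: measurable_funD => //; exact/mr/ms.
have mE : measurable_fun setT (fun w => \1_D w * (e / (1 + e))).
  by apply: measurable_funM => //; exact: measurable_indic.
have A0 w : 0 <= A w by rewrite divr_ge0 ?addr_ge0 ?sabs_ge0.
have B0 w : 0 <= B w by rewrite !addr_ge0 ?sabs_ge0.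
have E0 w : 0 <= \1_D w * (e / (1 + e)) by rewrite mulr_ge0.
have intE : (\int[lambda]_w (\1_D w * (e / (1 + e)))%:E =
    lambda D * (e / (1 + e))%:E)%E.
  under eq_integral do rewrite EFinM.
  rewrite ge0_integralZr//; first by rewrite integral_indic// setIT.
  by apply/measurable_EFinP; exact: measurable_indic.
have intA : (\int[lambda]_w (A w)%:E =
    ((rnorm (one + v) + rnorm (- one + v)) / 2)%:E)%E.
  under eq_integral do rewrite EFinM EFinD.
  rewrite ge0_integralZr//; last 2 first.
  - by apply: emeasurable_funD; exact: ms.
  - by move=> w _; rewrite adde_ge0.
  by rewrite ge0_integralD//; rewrite -?rnorm_L1//; exact: ms.
have intB : (\int[lambda]_w (B w)%:E = (rnorm a + (1 + rnorm v))%:E)%E.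
  under eq_integral do rewrite !EFinD.
  rewrite ge0_integralD//; last 3 first.
  - exact: ms.
  - by move=> w _; rewrite adde_ge0.
  - by apply: emeasurable_funD => //; exact: ms.
  rewrite ge0_integralD//; last exact: ms.
  by rewrite -!rnorm_L1 integral_cst_probability.
rewrite -intE -intA -intB -ge0_integralD//; last 4 first.
- by move=> w _; rewrite lee_fin.
- exact/measurable_EFinP.
- by move=> w _; rewrite lee_fin.
- exact/measurable_EFinP.
apply: ae_ge0_le_integral => //.
- by move=> w _; rewrite adde_ge0 ?lee_fin.
- by apply: emeasurable_funD; exact/measurable_EFinP.
- by move=> w _; rewrite lee_fin.
- exact/measurable_EFinP.
have aE : {ae lambda, forall w, L1_fun a w =
    L1_fun f w - L1_fun g w - s * L1_fun v w}.
  have := L1_funZD (-1) g f; rewrite scaleN1r addrC => fgE.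
  have := L1_funZD (- s) v (f - g); rewrite scaleNr addrC.
  apply: filterS2 fgE => w fgE ->.
  by rewrite fgE mulN1r mulNr addrC [_ + L1_fun f w]addrC.
have posE : {ae lambda, forall w, L1_fun (one + v) w = 1 + L1_fun v w}.
  have := L1_funZD 1 one v; rewrite scale1r.
  by apply: filterS2 one1 => w oneE ->; rewrite mul1r oneE.
have negE : {ae lambda, forall w, L1_fun (- one + v) w = -1 + L1_fun v w}.
  have := L1_funZD (-1) one v; rewrite scaleN1r.
  by apply: filterS2 one1 => w oneE ->; rewrite mulN1r oneE.
apply: filterS3 aE posE negE => w aE posE negE _.
rewrite -EFinD lee_fin /A /B posE negE.
have [Dw|nDw] := pselect (D w).
  rewrite indicE mem_set// mul1r; apply: (sabs_two_points_far e0 Dw).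
  (* On [D] the difference is the error plus [s * y], and [s] has modulus at most 1. *)
  rewrite aE; set x := _ - _; set y := L1_fun v w.
  rewrite -{1}(subrK (s * y) x); apply: le_trans (sabsD _ _) _.
  by rewrite lerD2l sabsM ler_piMl ?sabs_ge0.
rewrite indicE memNset// mul0r add0r.
have := sabs_two_points_ge0 (L1_fun v w); have := sabs_ge0 (L1_fun a w); lra.
Qed.
End L1.

(** * Scaling, and the approximation in measure *)

Lemma unit_multiple (R : realType) (k : scalar_kind)
    (W : normedModType (scalars R k)) (w f : W) :
  rnorm w = 1 -> exists2 y, rnorm y = 1 & f = sreal k (rnorm f) *: y.
Proof.
move=> w1; have [f0|f0] := eqVneq (rnorm f) 0.
  (* When [f] is zero any unit vector will do, and [w] provides one. *)
  exists w => //; rewrite f0 sreal0 scale0r.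
  by apply/eqP; rewrite -rnorm_eq0 f0.
exists (sreal k (rnorm f)^-1 *: f).
  by rewrite rnormZ sabs_real ger0_norm ?invr_ge0 ?rnorm_ge0// mulVf.
by rewrite scalerA -srealM divff// sreal1 scale1r.
Qed.

(** The approximant [g] has norm at most [2 + 3 * e], slightly more than 2, so a factor slightly
    below [r / 2] is needed to bring it into the unit ball. *)
Lemma exists_near_half (R : realFieldType) (r e : R) :
  0 <= r -> r <= 1 -> 0 < e ->
  exists s, [/\ 0 <= s, s <= 1, s * (2 + 3 * e) = r & 0 <= r / 2 - s <= 3 * e].
Proof.
move=> r0 r1 e0; have e2 : 0 < 2 + 3 * e by lra.
have s0 : 0 <= r / (2 + 3 * e) by rewrite divr_ge0// ltW.
have sE : r / (2 + 3 * e) * (2 + 3 * e) = r by rewrite divfK// gt_eqF.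
exists (r / (2 + 3 * e)); move: (r / (2 + 3 * e)) s0 sE => s s0 sE.
have se : 0 <= s * e := mulr_ge0 s0 (ltW e0).
have s1 : 0 <= 1 - s by lra.
have := mulr_ge0 s1 (ltW e0) => es.
by split=> //; [lra|apply/andP; split; lra].
Qed.

Theorem proposition2p2 (d : measure_display) (Omega : measurableType d)
    (R : realType) (lambda : probability Omega R) (k : scalar_kind)
    (X : submodClosed (L1 lambda k)) (clX : closed [set` X]) :
  rich clX ->
  [set 2^-1 *: f | f in unit_ball (L1 lambda k)] `<=` C_ X.
Proof.
move=> richX _ [f /unit_ballE f1 <-]; apply/C_P => del del0.
have [one oneE] := L1_one lambda k; have one1 := rnorm_L1_one oneE.
have [y y1 fE] := unit_multiple f one1.
set r := rnorm f in f1 fE; have r0 : 0 <= r := rnorm_ge0 f.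
pose c := del / (1 + del).
have c0 : 0 < c by rewrite divr_gt0// addr_gt0.
(* The 10 is 6 from the norm of the error [a] plus 4 from the defect of [one + v] and
   [- one + v]. *)
have [e [e0 e1 edc]] : exists e, [/\ 0 < e, e < 1 & 10 * e <= del * c].
  have dc0 : 0 < del * c / 10 by rewrite divr_gt0// mulr_gt0.
  exists (Num.min 2^-1 (del * c / 10)); split.
  - by rewrite lt_min dc0 andbT invr_gt0.
  - by rewrite gt_min invf_lt1 ?ltr1n.
  - by rewrite mulrC -ler_pdivlMr// ge_min lexx orbT.
have e01 : 0 < e < 1 by rewrite e0.
have one1N : rnorm (- one) = 1 by rewrite rnormN.
have [s [s0 s1 sE rs]] := exists_near_half r0 f1 e0.
have [v [v1 onev Nonev /rnorm_quotient_lt[g gX yvg]]] :=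
  narrow_two_points (@L1_norming _ _ _ lambda k) (rnorm_quotient_le clX) richX
    one1 one1N y1 e01.
exists (sreal k s *: g); split; first exact: rpredZ.
  apply/unit_ballE; rewrite rnormZ sabs_real ger0_norm//.
  apply: (@le_trans _ _ (s * (2 + 3 * e))); last by rewrite sE.
  apply: ler_wpM2l => //; rewrite -[g](subKr (y - v)).
  apply: le_trans (rnormD _ _) _; rewrite rnormN; apply: lerD (ltW yvg).
  by apply: le_trans (rnormD _ _) _; rewrite rnormN y1 lerD2l.
rewrite /measure_ball.
have := L1_two_points (2^-1 *: f) (sreal k s *: g) v oneE del0 (s := sreal k s).
rewrite sabs_real ger0_norm// => /(_ s1).
set D := [set w | _]; set a := _ - _ - _ => two.
(* The first term comes from approximating [y - v] inside [X], the second from replacing [r / 2] by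
   [s]; each has norm at most [3 * e]. *)
have aE : a = sreal k s *: (y - v - g) + sreal k (r / 2 - s) *: y.
  rewrite /a fE srealD srealN srealM sreal_half scalerA [_ * 2^-1]mulrC.
  rewrite scalerDl scaleNr !scalerBr.
  by rewrite [RHS]addrC !addrA subrK addrAC.
have a1 : rnorm a <= 3 * e + 3 * e.
  have /andP[rs0 rs1] := rs; rewrite aE; apply: le_trans (rnormD _ _) _.
  rewrite !rnormZ y1 mulr1 !sabs_real (ger0_norm s0) (ger0_norm rs0) lerD//.
  by apply: le_trans (ltW yvg); rewrite ler_piMl ?rnorm_ge0.
have mD : lambda D \is a fin_num.
  exact: fin_num_measure (measurable_dist_ge _ _ _).
rewrite -(fineK mD) lte_fin.
move: two; rewrite -(fineK mD) -EFinM -EFinD lee_fin -/c => two.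
rewrite -(ltr_pM2r c0); move: two a1 v1 onev Nonev edc; clear.
move: (rnorm a) (rnorm v) (rnorm (one + v)) (rnorm (- one + v)) => na nv p q.
(* Since [nv <= 1] and [(p + q) / 2 > 2 - 4 * e], the measure of [D] times [c] is below
   [6 * e + 4 * e], hence below [del * c]. *)
by move: (fine _ * c) (del * c) => m dc; lra.
Qed.
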